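(* Let $G$ be a finite group, let $\chi$ be an irreducible character of the Drinfel'd double $D(G)$, and let $\sigma$ be a Hopf automorphism of $D(G)$. Define $\chi^\sigma(h)=\chi(\sigma(h))$ for $h\in D(G)$. Then $\nu_m(\chi^\sigma)=\nu_m(\chi)$ for all $m\in\mathbb{N}$ ($m\geq 1$).
   Context: For a finite group $G$, the Drinfel'd double $D(G)$ is the semisimple Hopf algebra over $\mathbb{C}$ with basis $\{p_g\bowtie x : g,x\in G\}$, multiplication $(p_k\bowtie z)(p_h\bowtie y)=\delta_{k,zhz^{-1}}\,p_k\bowtie zy$, unit $\sum_{g\in G}p_g\bowtie 1$, comultiplication $\Delta(p_g\bowtie x)=\sum_{h\in G}(p_h\bowtie x)\otimes(p_{h^{-1}g}\bowtie x)$, counit $\epsilon(p_g\bowtie x)=\delta_{g,1}$ and antipode $S(p_g\bowtie x)=p_{x^{-1}g^{-1}x}\bowtie x^{-1}$. A Hopf automorphism is a bijective linear map preserving all of this structure. Put $\Lambda=\frac1{|G|}\sum_{g\in G}p_1\bowtie g$ (the unique integral of $D(G)$ with $\epsilon(\Lambda)=1$). For $m\ge 1$, $\Lambda^{[m]}=\sum\Lambda_1\Lambda_2\cdots\Lambda_m$ is the result of applying the $m$-fold multiplication to the iterated comultiplication $\Delta^{m-1}(\Lambda)\in D(G)^{\otimes m}$ (with $\Lambda^{[1]}=\Lambda$). An irreducible character $\chi$ of $D(G)$ is the trace function of a simple $D(G)$-module, and its $m$-th Frobenius-Schur indicator is $\nu_m(\chi)=\chi(\Lambda^{[m]})$. 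*)

(* Defs.v *)
From HB Require Import structures.
From mathcomp Require Import all_boot all_order all_fingroup all_algebra.
From mathcomp Require Export reals complex.

Set Implicit Arguments.
Unset Strict Implicit.
Unset Printing Implicit Defensive.

Import GRing.Theory.
Local Open Scope ring_scope.

(* An element of D(G) is its family of coordinates in the basis p_g ⋈ x,
   indexed by the pairs (g, x).  The alias is there because {ffun _ -> _}
   already carries the pointwise product. *)
Definition drinfeld_double (K : fieldType) (gT : finGroupType) : Type :=
  {ffun gT * gT -> K^o}.

HB.instance Definition _ (K : fieldType) (gT : finGroupType) :=
  Vector.copy (drinfeld_double K gT) {ffun gT * gT -> K^o}.

(* The K-linear map sending the u-th coordinate vector to f u. *)
Definition lin_ext (K : fieldType) (I : finType) (V : lmodType K)
  (f : I -> V) (a : {ffun I -> K^o}) : V := \sum_u (a u : K) *: f u.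

Section Algebra.
Variables (K : fieldType) (gT : finGroupType).
Local Notation D := (drinfeld_double K gT).
Implicit Types (a b c : D) (u v w : gT * gT) (g x : gT).

(* dbas (g, x) is p_g ⋈ x. *)
Definition dbas u : D := [ffun v => (v == u)%:R].

Definition dmul_bas u v : D :=
  (u.1 == u.2 * v.1 * u.2^-1)%g%:R *: dbas (u.1, (u.2 * v.2)%g).

Definition dmul a b : D :=
  lin_ext (fun u => lin_ext (fun v => dmul_bas u v) b) a.

Definition dunit : D := \sum_g dbas (g, 1%g).


Fact dmulE a b g x :
  dmul a b (g, x) = \sum_z (a (g, z) : K) * b (g ^ z, z^-1 * x)%g.
Proof.
rewrite /dmul /lin_ext sum_ffunE.
transitivity (\sum_(u | u.1 == g) (a u : K) * b (u.1 ^ u.2, u.2^-1 * x)%g).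
  rewrite [RHS]big_mkcond /=; apply: eq_bigr => -[k z] _ /=.
  rewrite ffunE sum_ffunE (bigD1 (k ^ z, z^-1 * x)%g) //= big1 => [|[h y] nhy].
    rewrite addr0 !ffunE /= conjgE mulKVg mulgK mulKVg eqxx xpair_eqE eqxx andbT.
    by rewrite eq_sym; case: eqP => _; rewrite /GRing.scale /= ?(mulr1, mulr0).
  rewrite !ffunE /= /GRing.scale /=.
  case: eqP => [ek|]; last by rewrite mul0r mulr0.
  case: eqP => [[eg ex]|]; last by rewrite !mulr0.
  case/eqP: nhy; congr (_, _); last by rewrite ex mulKg.
  by rewrite ek conjgE -!mulgA mulKg mulVg mulg1.
rewrite (reindex (fun z => (g, z))) /=; first by apply: eq_big => // z; rewrite eqxx.
by exists snd => [//|[k z]] /eqP /= ->.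
Qed.

Fact dunitE g x : dunit (g, x) = (x == 1%g)%:R.
Proof.
rewrite /dunit sum_ffunE (bigD1 g) //= big1 => [|h nhg].
  by rewrite addr0 ffunE xpair_eqE eqxx.
by rewrite ffunE xpair_eqE eq_sym (negPf nhg).
Qed.

Fact dmulA : associative dmul.
Proof.
move=> a b c; apply/ffunP => -[g x]; rewrite !dmulE.
under eq_bigr => z _ do rewrite dmulE mulr_sumr.
under [RHS]eq_bigr => z _ do rewrite dmulE mulr_suml.
rewrite [RHS]exchange_big; apply: eq_bigr => z _ /=.
rewrite [RHS](reindex_inj (mulgI z)); apply: eq_bigr => w _ /=.
by rewrite mulrA mulKg conjgM invMg mulgA.
Qed.

Fact dmul1l : left_id dunit dmul.
Proof.
move=> a; apply/ffunP => -[g x]; rewrite dmulE (bigD1 1%g) //= big1 => [|z nz1].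
  by rewrite dunitE eqxx mul1r conjg1 invg1 mul1g addr0.
by rewrite dunitE (negPf nz1) mul0r.
Qed.

Fact dmul1r : right_id dunit dmul.
Proof.
move=> a; apply/ffunP => -[g x]; rewrite dmulE (bigD1 x) //= big1 => [|z nzx].
  by rewrite dunitE mulVg eqxx mulr1 addr0.
by rewrite dunitE -eq_mulVg1 (negPf nzx) mulr0.
Qed.

Fact dmulDl : left_distributive dmul +%R.
Proof.
move=> a b c; apply/ffunP => -[g x]; rewrite ffunE !dmulE -big_split.
by apply: eq_bigr => z _; rewrite ffunE mulrDl.
Qed.

Fact dmulDr : right_distributive dmul +%R.
Proof.
move=> a b c; apply/ffunP => -[g x]; rewrite ffunE !dmulE -big_split.
by apply: eq_bigr => z _; rewrite ffunE mulrDr.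
Qed.

Fact dunit_neq0 : dunit != 0.
Proof.
apply/eqP => /ffunP/(_ (1%g, 1%g)); rewrite dunitE eqxx ffunE.
exact/eqP/oner_neq0.
Qed.

Fact dmulZl (k : K) a b : k *: dmul a b = dmul (k *: a) b.
Proof.
apply/ffunP => -[g x]; rewrite ffunE !dmulE [LHS]mulr_sumr.
by apply: eq_bigr => z _; rewrite ffunE mulrA.
Qed.

Fact dmulZr (k : K) a b : k *: dmul a b = dmul a (k *: b).
Proof.
apply/ffunP => -[g x]; rewrite ffunE !dmulE [LHS]mulr_sumr.
by apply: eq_bigr => z _; rewrite ffunE mulrCA.
Qed.

End Algebra.

HB.instance Definition _ (K : fieldType) (gT : finGroupType) :=
  GRing.Zmodule_isNzRing.Build (drinfeld_double K gT) (@dmulA K gT) (@dmul1l K gT)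
    (@dmul1r K gT) (@dmulDl K gT) (@dmulDr K gT) (@dunit_neq0 K gT).
HB.instance Definition _ (K : fieldType) (gT : finGroupType) :=
  GRing.Lmodule_isLalgebra.Build K (drinfeld_double K gT) (@dmulZl K gT).
HB.instance Definition _ (K : fieldType) (gT : finGroupType) :=
  GRing.Lalgebra_isAlgebra.Build K (drinfeld_double K gT) (@dmulZr K gT).

(* D(G) ⊗ D(G) and the n-th tensor power of D(G), as coordinate families in
   the basis of tensor products of the p_g ⋈ x. *)
Definition dtens2 (K : fieldType) (gT : finGroupType) : Type :=
  {ffun (gT * gT) * (gT * gT) -> K^o}.
Definition dtens (K : fieldType) (gT : finGroupType) (n : nat) : Type :=
  {ffun n.-tuple (gT * gT) -> K^o}.

HB.instance Definition _ (K : fieldType) (gT : finGroupType) :=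
  Vector.copy (dtens2 K gT) {ffun (gT * gT) * (gT * gT) -> K^o}.
HB.instance Definition _ (K : fieldType) (gT : finGroupType) (n : nat) :=
  Vector.copy (dtens K gT n) {ffun n.-tuple (gT * gT) -> K^o}.

Section Hopf.
Variables (K : fieldType) (gT : finGroupType).
Local Notation D := (drinfeld_double K gT).
Implicit Types (a b : D) (f : D -> D) (n m : nat).

(* a ⊗ b *)
Definition pure2 a b : dtens2 K gT := [ffun w => (a w.1 : K) * b w.2].

(* f ⊗ f, for a linear map f *)
Definition tens_map f : dtens2 K gT -> dtens2 K gT :=
  lin_ext (fun w => pure2 (f (dbas K w.1)) (f (dbas K w.2))).

Definition comul : D -> dtens2 K gT :=
  lin_ext (fun u => \sum_h pure2 (dbas K (h, u.2))
                                 (dbas K ((h^-1 * u.1)%g, u.2))).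

Definition counit : D -> K^o := lin_ext (fun u => (u.1 == 1%g)%:R : K^o).

Definition antipode : D -> D :=
  lin_ext (fun u => dbas K ((u.2^-1 * u.1^-1 * u.2)%g, u.2^-1%g)).

Record hopf_automorphism (sigma : D -> D) : Prop := HopfAutomorphism {
  hopf_aut_linear : linear sigma;
  hopf_aut_bij : bijective sigma;
  hopf_aut_unit : sigma 1 = 1;
  hopf_aut_mul : {morph sigma : a b / a * b};
  hopf_aut_comul : forall a, comul (sigma a) = tens_map sigma (comul a);
  hopf_aut_counit : forall a, counit (sigma a) = counit a;
  hopf_aut_antipode : {morph sigma : a / antipode a}
}.

(* Λ *)
Definition integral : D := (#|gT|%:R^-1 : K) *: \sum_(g : gT) dbas K (1%g, g).

(* a ⊗ T in D(G) ⊗ D(G)^{⊗n} = D(G)^{⊗(n+1)} *)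
Definition pure_cons n a (T : dtens K gT n) : dtens K gT n.+1 :=
  [ffun t => (a (thead t) : K) * T (behead_tuple t)].

(* Δ^n : D(G) -> D(G)^{⊗(n+1)}, with Δ^0 = id and Δ^{n+1} = (id ⊗ Δ^n) ∘ Δ. *)
Fixpoint iter_comul n : D -> dtens K gT n.+1 :=
  if n is n'.+1 then fun a =>
    lin_ext (fun w => pure_cons (dbas K w.1) (iter_comul n' (dbas K w.2)))
      (comul a)
  else fun a => [ffun t => a (thead t)].

Definition iter_mul m : dtens K gT m -> D :=
  lin_ext (fun t : m.-tuple (gT * gT) => \prod_(u <- t) dbas K u).

(* a^[m]; the value ε(a)1 at m = 0 is only a convention. *)
Definition sweedler_power m a : D :=
  if m is n.+1 then iter_mul (iter_comul n a) else (counit a : K) *: 1.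

Definition fs_indicator m (chi : D -> K) : K := chi (sweedler_power m integral).

(* Left modules are taken finite-dimensional, so that the trace makes sense;
   simple modules over the finite-dimensional algebra D(G) always are. *)
Definition is_dmodule (V : vectType K) (rho : D -> 'End(V)) : Prop :=
  [/\ linear rho, rho 1 = \1%VF & forall a b, rho (a * b) = (rho a \o rho b)%VF].

Definition is_simple_dmodule (V : vectType K) (rho : D -> 'End(V)) : Prop :=
  [/\ is_dmodule rho, {: V}%VS <> 0%VS &
      forall U : {vspace V}, (forall a, (rho a @: U <= U)%VS) ->
        U = 0%VS \/ U = {: V}%VS].

Definition lfun_trace (V : vectType K) (f : 'End(V)) : K :=
  \tr (passmx.mxof (vbasis {: V}) (vbasis {: V}) f).

Definition irreducible_character (chi : D -> K) : Prop :=
  exists (V : vectType K) (rho : D -> 'End(V)),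
    is_simple_dmodule rho /\ forall a, chi a = lfun_trace (rho a).

End Hopf.

(* Main.v *)
Require Import Defs.
From mathcomp Require Import all_boot all_order all_fingroup all_algebra.
From mathcomp Require Import reals complex.

(** The Sweedler power h |-> h^[m] is built from the product and the coproduct
    alone, so a Hopf automorphism sigma commutes with it
    ([sweedler_power_aut]); hence nu_m(chi^sigma) is chi applied to
    (sigma Lambda)^[m], and it remains to see that sigma Lambda = Lambda
    ([aut_integral]).  This holds because Lambda is a two-sided integral with
    counit 1: sigma Lambda is again a left integral with counit 1, so the
    product Lambda * sigma Lambda equals both sigma Lambda and Lambda.

    To compare the Sweedler powers without ever letting sigma act on m-fold
    tensors, the definition through the m-fold tensor power is first turned
    into the recursion h^[m+1] = sum h_1 (h_2)^[m] ([sweedler_powerS]), in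
    which only D(G) (x) D(G) occurs. *)

Set Implicit Arguments.
Unset Strict Implicit.
Unset Printing Implicit Defensive.

Import GRing.Theory Num.Theory.
Local Open Scope ring_scope.
Local Open Scope complex_scope.

Section LinearExtension.
Variables (K : fieldType) (I : finType) (V : lmodType K).
Implicit Types (f : I -> V) (a : {ffun I -> K^o}).

Lemma linear_sumZ (U W : lmodType K) (g : U -> W) (J : finType)
    (k : J -> K) (v : J -> U) :
  linear g -> g (\sum_j k j *: v j) = \sum_j k j *: g (v j).
Proof.
move=> g_lin.
have g0 : g 0 = 0.
  have := g_lin 1 0 0; rewrite !scale1r addr0 => /eqP.
  by rewrite -subr_eq subrr eq_sym => /eqP.
elim/big_rec2: _ => // j y x _ <-; exact: g_lin.
Qed.

Lemma lin_ext_linear f : linear (lin_ext f : {ffun I -> K^o} -> V).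
Proof.
move=> k a b; rewrite /lin_ext scaler_sumr -big_split /=.
by apply: eq_bigr => i _; rewrite !ffunE scalerDl scalerA.
Qed.

Lemma eq_lin_ext f f' a : f =1 f' -> lin_ext f a = lin_ext f' a.
Proof. by move=> eqf; apply: eq_bigr => i _; rewrite eqf. Qed.

Lemma linear_lin_ext (W : lmodType K) (g : V -> W) f a :
  linear g -> g (lin_ext f a) = lin_ext (g \o f) a.
Proof. by move=> g_lin; rewrite /lin_ext linear_sumZ. Qed.

End LinearExtension.

Section DrinfeldDouble.
Variables (K : fieldType) (gT : finGroupType).
Local Notation D := (drinfeld_double K gT).
Implicit Types (a b : D) (sigma : D -> D).

Lemma lin_ext_dbas a : lin_ext (@dbas K gT) a = a.
Proof.
apply/ffunP => v; rewrite /lin_ext sum_ffunE (bigD1 v) //= big1 => [|u nuv].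
  by rewrite !ffunE eqxx addr0 [LHS]mulr1.
by rewrite !ffunE eq_sym (negPf nuv) [LHS]mulr0.
Qed.

Lemma iter_comul_linear n : linear (@iter_comul K gT n).
Proof.
case: n => [|n] k a b /=; first by apply/ffunP => t; rewrite !ffunE.
by rewrite [comul _]lin_ext_linear lin_ext_linear.
Qed.

Lemma iter_mul_linear n : linear (@iter_mul K gT n).
Proof. exact: lin_ext_linear. Qed.

Lemma sweedler_power_linear n : linear (@sweedler_power K gT n.+1).
Proof. by move=> k a b /=; rewrite iter_comul_linear iter_mul_linear. Qed.

Lemma iter_mul_cons n a (T : dtens K gT n) :
  iter_mul (pure_cons a T) = a * iter_mul T.
Proof.
rewrite -[in RHS](lin_ext_dbas a) /iter_mul /lin_ext mulr_suml.
rewrite (reindex (fun p : (gT * gT) * n.-tuple (gT * gT) => [tuple of p.1 :: p.2])).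
  rewrite -(pair_bigA _ (fun u (s : n.-tuple _) =>
     (pure_cons a T [tuple of u :: s] : K) *: \prod_(v <- u :: s) dbas K v)) /=.
  apply: eq_bigr => u _; rewrite mulr_sumr; apply: eq_bigr => s _.
  rewrite big_cons ffunE theadE -scalerAl -scalerAr scalerA.
  by congr ((_ * T _) *: _); apply: val_inj.
exists (fun t : n.+1.-tuple _ => (thead t, behead_tuple t)) => [[u s] _ | t _] /=.
  by rewrite theadE; congr (_, _); apply: val_inj.
by rewrite [RHS]tuple_eta; apply: val_inj.
Qed.

Lemma sweedler_power1 a : sweedler_power 1 a = a.
Proof.
rewrite -[RHS]lin_ext_dbas /= /iter_mul /lin_ext.
rewrite (reindex (fun u : gT * gT => [tuple u])) /=; last first.
  exists (fun t => thead t) => [u _ | t _]; first by rewrite theadE.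
  by case/tupleP: t => u s; rewrite theadE (tuple0 s); apply: val_inj.
by apply: eq_bigr => u _; rewrite ffunE theadE big_seq1.
Qed.

(** a (x) b |-> a b^[n]. *)
Definition mul_power n : dtens2 K gT -> D :=
  lin_ext (fun w => dbas K w.1 * sweedler_power n (dbas K w.2)).

(** The m-fold tensor power disappears: it is built one factor at a time by
    [pure_cons], which the product turns into a left multiplication. *)
Lemma sweedler_powerS n a :
  sweedler_power n.+2 a = mul_power n.+1 (comul a).
Proof.
rewrite /= linear_lin_ext; last exact: iter_mul_linear.
by apply: eq_lin_ext => w /=; rewrite iter_mul_cons.
Qed.

Lemma mul_power_pure2 n a b :
  mul_power n.+1 (pure2 a b) = a * sweedler_power n.+1 b.
Proof.
rewrite -[in RHS](lin_ext_dbas a) -[in RHS](lin_ext_dbas b).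
rewrite linear_lin_ext; last exact: sweedler_power_linear.
rewrite /mul_power /lin_ext mulr_suml.
under [RHS]eq_bigr => u _ do rewrite mulr_sumr.
rewrite pair_bigA; apply: eq_bigr => w _ /=.
by rewrite ffunE -scalerAl -scalerAr scalerA.
Qed.

(** In h^[n+1] = sum h_1 (h_2)^[n], the map sigma passes to h_1 by
    multiplicativity and to (h_2)^[n] by induction; the comultiplicativity of
    sigma says that sum sigma h_1 (x) sigma h_2 is the coproduct of sigma h. *)
Lemma sweedler_power_aut sigma n a : hopf_automorphism sigma ->
  sigma (sweedler_power n.+1 a) = sweedler_power n.+1 (sigma a).
Proof.
case=> sigma_lin _ _ sigmaM sigma_comul _ _.
elim: n a => [|n IHn] a; first by rewrite !sweedler_power1.
rewrite !sweedler_powerS sigma_comul /tens_map.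
rewrite (linear_lin_ext (g := sigma)) //.
rewrite (linear_lin_ext (g := @mul_power n.+1)); last exact: lin_ext_linear.
by apply: eq_lin_ext => w; rewrite /= mul_power_pure2 sigmaM IHn.
Qed.

Lemma integralE g x :
  integral K gT (g, x) = (#|gT|%:R^-1 : K) * (g == 1%g)%:R.
Proof.
rewrite ffunE sum_ffunE; congr (_ * _).
rewrite (bigD1 x) //= big1 => [|y nyx].
  by rewrite ffunE xpair_eqE eqxx andbT addr0.
by rewrite ffunE xpair_eqE [x == y]eq_sym (negPf nyx) andbF.
Qed.

Lemma counitE a : counit a = \sum_x (a (1%g, x) : K).
Proof.
transitivity (\sum_g \sum_x (a (g, x) : K) *: ((g == 1%g)%:R : K^o)).
  by rewrite pair_bigA; apply: eq_bigr => -[].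
rewrite (bigD1 1%g) //= [X in _ + X]big1 => [|g ng1].
  by rewrite addr0 eqxx; apply: eq_bigr => x _; apply: mulr1.
by apply: big1 => x _; rewrite (negPf ng1) scaler0.
Qed.

(** The integral is supported on the p_1 >< x, where it is constant; as 1 is
    fixed under conjugation, multiplying by a only sums a over these basis
    vectors, and this sum is the counit of a ([counitE]). *)
Lemma left_integral a : a * integral K gT = (counit a : K) *: integral K gT.
Proof.
apply/ffunP => -[g x]; rewrite [LHS]dmulE ffunE integralE counitE.
under eq_bigr => z _ do rewrite integralE conjg_eq1.
rewrite -mulr_suml; case: eqP => [-> //|_].
by rewrite !mulr0 [RHS]mulr0.
Qed.

Lemma right_integral a : integral K gT * a = (counit a : K) *: integral K gT.
Proof.
apply/ffunP => -[g x]; rewrite [LHS]dmulE ffunE integralE counitE.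
under eq_bigr => z _ do rewrite integralE.
rewrite -mulr_sumr [RHS]mulrC; case: eqP => [->|_]; last by rewrite !mulr0 !mul0r.
congr (_ * _); rewrite [RHS](reindex_inj (mulIg x)) [RHS](reindex_inj invg_inj) /=.
by apply: eq_bigr => z _; rewrite conj1g.
Qed.

(** The Maschke condition on the characteristic is what allows the integral to
    be normalised. *)
Lemma counit_integral : #|gT|%:R != 0 :> K -> counit (integral K gT) = 1.
Proof.
move=> G_neq0; rewrite counitE; under eq_bigr => x _ do rewrite integralE eqxx.
rewrite mulr1 sumr_const -[LHS]mulr_natr; exact: mulVf.
Qed.

(** A left integral l and a right integral r, both of counit 1, coincide, since
    r = r * l = l; this applies to l = sigma Lambda and r = Lambda. *)
Lemma aut_integral sigma : #|gT|%:R != 0 :> K -> hopf_automorphism sigma ->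
  sigma (integral K gT) = integral K gT.
Proof.
move=> G_neq0 [sigma_lin [tau _ tauK] _ sigmaM _ sigma_counit _].
set L := integral K gT.
have sigmaZ k a : sigma (k *: a) = k *: sigma a.
  have := linear_sumZ (fun=> k) (fun _ : 'I_1 => a) sigma_lin.
  by rewrite !big_ord1.
have left_sigma a : a * sigma L = (counit a : K) *: sigma L.
  by rewrite -[a]tauK -sigmaM left_integral sigmaZ sigma_counit.
(* sigma L = counit L *: sigma L = L * sigma L = counit (sigma L) *: L = L. *)
rewrite -[LHS]scale1r -(counit_integral G_neq0) -left_sigma.
by rewrite right_integral sigma_counit counit_integral // scale1r.
Qed.

End DrinfeldDouble.

Theorem proposition2p3p11 (R : realType) (gT : finGroupType)
    (chi : drinfeld_double R[i] gT -> R[i]) (sigma : drinfeld_double R[i] gT -> drinfeld_double R[i] gT)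
    (chi_irr : irreducible_character chi)
    (sigma_aut : hopf_automorphism sigma)
    (m : nat) (m_ge1 : (1 <= m)%N) :
  fs_indicator m (fun h => chi (sigma h)) = fs_indicator m chi.
Proof.
case: m m_ge1 => // n _.
have G_neq0 : #|gT|%:R != 0 :> R[i].
  by rewrite pnatr_eq0 -lt0n; apply/card_gt0P; exists 1%g.
by rewrite /fs_indicator sweedler_power_aut // aut_integral.
Qed.
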